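(* Let $n$ and $s$ be positive integers and let $a_1,\ldots,a_s$ be integers. Consider the Diophantine equation $$\sum_{i=1}^{s}a_i x_i^n=y^{n+1}$$ in the unknowns $x_1,\ldots,x_s,y$. Suppose that for every nonempty $\Gamma\subseteq[s]$ one has (1) $\sum_{i\in\Gamma}a_i\neq 0$; (2) $\sum_{i=1}^s a_i+n\sum_{i\in[s]\setminus\Gamma}a_i\neq 0$. Then the equation is not partition regular on $\mathbb{N}$, except possibly for constant solutions.
   Context: $\mathbb{N}$ denotes the set of positive integers and $[s]=\{1,\ldots,s\}$. An equation $f(x_1,\ldots,x_n)=0$ is partition regular on $\mathbb{N}$ if for every finite coloring (partition) $\mathbb{N}=C_1\cup\ldots\cup C_r$ there exist an index $i$ and elements $a_1,\ldots,a_n\in C_i$ (not necessarily distinct) with $f(a_1,\ldots,a_n)=0$; such a solution is called monochromatic. A solution is constant if all unknowns take the same value. ''Not partition regular on $\mathbb{N}$, except possibly for constant solutions'' means: there is a finite coloring of $\mathbb{N}$ for which every monochromatic solution of the equation (if there is any) is constant. *)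

(* Defs.v *)
From mathcomp Require Import all_boot all_order all_algebra.

Set Implicit Arguments.
Unset Strict Implicit.
Unset Printing Implicit Defensive.

Import GRing.Theory Num.Theory.
Local Open Scope ring_scope.

(* Positive integers are the nonzero elements of nat.  A colouring is a total
   function on nat, but only its values at positive integers are ever used. *)

Definition is_solution (m : nat) (f : ('I_m -> int) -> int)
    (z : 'I_m -> nat) : Prop :=
  (forall j, (0 < z j)%N) /\ f (fun j => (z j)%:Z) = 0.

Definition monochromatic (m r : nat) (c : nat -> 'I_r) (z : 'I_m -> nat) :
    Prop :=
  exists k : 'I_r, forall j, c (z j) = k.

Definition constant_tuple (m : nat) (z : 'I_m -> nat) : Prop :=
  forall j k, z j = z k.

Definition not_PR_except_constant (m : nat) (f : ('I_m -> int) -> int) : Prop :=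
  exists (r : nat) (c : nat -> 'I_r),
    forall z : 'I_m -> nat,
      is_solution f z -> monochromatic c z -> constant_tuple z.

(* The unknowns are indexed by 'I_s.+1: the last one is y, the others are
   x_1, ..., x_s. *)
Definition power_sum_eqn (n s : nat) (a : 'I_s -> int) (z : 'I_s.+1 -> int) : int :=
  \sum_(i < s) a i * z (lift ord_max i) ^+ n - z ord_max ^+ n.+1.

(* Main.v *)
Require Import Defs.
From mathcomp Require Import all_boot all_order all_algebra.
From mathcomp Require Import zify ring.

Import GRing.Theory Num.Theory.
Local Open Scope ring_scope.

(** Why the theorem is true.  Write A for the sum of the a_i, and let p be a
    prime that divides none of the finitely many sums of coefficients that h1 and
    h2 show to be nonzero.  If finitely many nonzero integers z_i have the same last
    nonzero digit d in base p, then a form in the z_i^k is easy to control: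
    modulo the next power of p, only the terms of minimal valuation count, each
    contributes its coefficient times d^k, and the form has exactly the expected
    valuation as soon as no nonempty subset of its coefficients has sum zero
    modulo p (same_digit_power_sum).  The colouring makes this principle
    applicable twice.

    At the origin.  Colour x by its last nonzero digit.  By h1 the left-hand
    side of a monochromatic solution has valuation n times the least valuation v
    of the x_i, so n v = (n + 1) w with w the valuation of y.  A two-colouring
    of the valuations separates v from w unless both vanish
    (separating_coloring); recording also whether p divides x, all the unknowns
    are then prime to p.  They share a residue d modulo p, and the equation reads
    A d^n = d^(n+1), so all the unknowns are congruent to A.

    At the constant point.  All unknowns equal to A is the only possible constant
    solution.  Write every unknown as A + u_j with p dividing u_j, and colour x
    also by the last nonzero digit of x - A.  To first order the equation is
    A^(n-1) times the linear form n (sum of a_i u_i) - (n + 1) A u_y, and the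
    remainder is quadratic in the u_j.  The sums of coefficients of that linear
    form over nonempty subsets are nonzero precisely because of h1 and h2
    (tangent_coef_sum_neq0), so its valuation is the least valuation v of the
    u_j, whereas the quadratic remainder has valuation at least 2 v > v: no such
    solution exists (no_solution_near_constant).  The colour also records whether
    x = A, so either every u_j vanishes or none does, and only the constant
    solution is left. *)

(** * Last nonzero digits *)

(** The last nonzero base-p digit of z.  It is valued in 'F_p, so that the digits
    of a form can be computed by field arithmetic; negative z are needed, as the
    digit of x - A is part of the colour of x. *)
Definition digit (p : nat) (z : int) : 'F_p :=
  (z %/ p%:Z ^+ logn p `|z|)%Z%:~R.

Lemma Fp_intr_eq0 (p : nat) (z : int) :
  prime p -> (z%:~R == 0 :> 'F_p) = (p %| z)%Z.
Proof. by move=> p_pr; rewrite -(dvdz_pcharf (pchar_Fp p_pr)). Qed.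

Lemma dvdz_logn (p k : nat) (z : int) :
  prime p -> z != 0 -> (p%:Z ^+ k %| z)%Z = (k <= logn p `|z|)%N.
Proof. by move=> p_pr z0; rewrite dvdzE abszX pfactor_dvdn // absz_gt0. Qed.

Lemma logn_pfactor_mul {p : nat} (k : nat) {t : int} :
    prime p -> t%:~R != 0 :> 'F_p ->
  p%:Z ^+ k * t != 0 /\ logn p `|p%:Z ^+ k * t| = k.
Proof.
move=> p_pr t0; have pt : ~~ (p %| `|t|)%N.
  by move: t0; rewrite Fp_intr_eq0 // dvdzE.
have t_neq0 : t != 0 by apply: contraNneq pt => ->.
have p_gt0 := prime_gt0 p_pr; split.
  by rewrite mulf_neq0 // expf_neq0 //; lia.
rewrite abszM abszX lognM ?expn_gt0 ?p_gt0 ?absz_gt0 // pfactorK //.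
by rewrite logn_coprime ?addn0 // prime_coprime.
Qed.

Lemma digit_unramified {p : nat} {z : int} : ~~ (p %| z)%Z -> digit p z = z%:~R.
Proof.
by rewrite dvdzE => pz; rewrite /digit lognE (negPf pz) !andbF expr0 divz1.
Qed.

(** Divide every z i by p^v, where v is the least valuation.  Modulo p the
    quotients become d at the indices J of valuation v and 0 elsewhere, so the
    form becomes d^k times the sum of c over J, which is a unit.  The index i0
    only witnesses that I is inhabited. *)
Lemma same_digit_power_sum {I : finType} {p k : nat} {c z : I -> int}
    {d : 'F_p} (i0 : I) :
    prime p -> (0 < k)%N ->
    (forall J : {set I}, J != set0 -> ~~ (p %| \sum_(i in J) c i)%Z) ->
    (forall i, z i != 0) -> (forall i, digit p (z i) = d) ->
  exists j, [/\ forall i, (logn p `|z j| <= logn p `|z i|)%N,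
    \sum_i c i * z i ^+ k != 0 &
    logn p `|\sum_i c i * z i ^+ k| = (k * logn p `|z j|)%N].
Proof.
move=> p_pr k_gt0 hc z_neq0 zd.
case: (@arg_minnP _ i0 xpredT (fun i => logn p `|z i|)) => // j _ jmin.
exists j; set v := logn p `|z j|.
pose u i := (z i %/ p%:Z ^+ v)%Z; pose J := [set i | logn p `|z i| == v].
have zE i : z i = p%:Z ^+ v * u i.
  by rewrite mulrC divzK // dvdz_logn // jmin.
have uE i : (u i)%:~R = if i \in J then d else 0.
  rewrite inE; case: eqP => [vi | /eqP vi]; first by rewrite -(zd i) /digit vi.
  apply/eqP; rewrite Fp_intr_eq0 // -(@dvdz_mul2l (p%:Z ^+ v)); last first.
    by rewrite expf_neq0 //; have := prime_gt0 p_pr; lia.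
  by rewrite -zE -exprSr dvdz_logn // ltn_neqAle eq_sym vi jmin.
have jJ : j \in J by rewrite inE.
have d_neq0 : d != 0.
  have := uE j; rewrite jJ => <-; rewrite Fp_intr_eq0 //.
  apply/negP => pu; suff : (v < v)%N by rewrite ltnn.
  rewrite {2}/v -dvdz_logn // exprSr zE dvdz_mul2l ?pu //.
  by rewrite expf_neq0 //; have := prime_gt0 p_pr; lia.
have -> : \sum_i c i * z i ^+ k = p%:Z ^+ (k * v) * \sum_i c i * u i ^+ k.
  rewrite mulr_sumr; apply: eq_bigr => i _.
  by rewrite zE exprMn -exprM mulnC mulrCA.
have S_neq0 : (\sum_i c i * u i ^+ k)%:~R != 0 :> 'F_p.
  rewrite rmorph_sum /= (bigID (mem J)) /= [X in _ + X]big1 => [|i iJ].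
    rewrite addr0 (eq_bigr (fun i => (c i)%:~R * d ^+ k)) => [|i iJ].
      rewrite -mulr_suml mulf_neq0 ?expf_neq0 // -rmorph_sum Fp_intr_eq0 //.
      by apply: hc; apply/set0Pn; exists j.
    by rewrite rmorphM rmorphXn /= uE iJ.
  by rewrite rmorphM rmorphXn /= uE (negPf iJ) expr0n eqn0Ngt k_gt0 mulr0.
have [? ?] := logn_pfactor_mul (k * v) p_pr S_neq0.
by split=> // i; apply: jmin.
Qed.

(** * The choice of the prime and of the colours of valuations *)

Lemma prime_avoiding {I : finType} (f : I -> int) :
  exists2 p, prime p & forall i, f i != 0 -> ~~ (p %| f i)%Z.
Proof.
have [p p_gt p_pr] := prime_above (\max_i `|f i|).
exists p => // i fi; rewrite dvdzE; apply/negP => /dvdn_leq.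
rewrite absz_gt0 fi => /(_ isT); rewrite leqNgt => /negP; apply.
exact: leq_ltn_trans (leq_bigmax i) p_gt.
Qed.

(** For a prime q dividing n + 1, hence prime to n, the relation
    (n + 1) w = n v forces logn q v = logn q w + e with e = logn q n.+1 > 0.
    Cutting the values of logn q into blocks of length e, v and w lie in
    consecutive blocks, which have opposite parities. *)
Lemma separating_coloring (n : nat) : (0 < n)%N ->
  exists f : nat -> bool,
    forall v w, (0 < v)%N -> (n.+1 * w = n * v)%N -> f v != f w.
Proof.
move=> n_gt0; pose q := pdiv n.+1; pose e := logn q n.+1.
have q_pr : prime q by apply: pdiv_prime; rewrite ltnS.
have e_gt0 : (0 < e)%N by rewrite logn_gt0 mem_primes q_pr pdiv_dvd.
exists (fun v => odd (logn q v %/ e)) => v w v_gt0 vw.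
have w_gt0 : (0 < w)%N by have := muln_gt0 n v; rewrite -vw muln_gt0; lia.
have qn : logn q n = 0%N.
  apply: logn_coprime; rewrite (coprime_dvdl (pdiv_dvd n.+1)) //.
  by rewrite coprime_sym coprimenS.
have := congr1 (logn q) vw; rewrite !lognM // qn add0n -/e => <-.
by rewrite divnDl ?dvdnn // divnn e_gt0 add1n /=; case: (odd _).
Qed.

(** * The equation near its constant solution *)

Lemma linearize_exp (A u : int) (m : nat) :
  {t | (A + u) ^+ m.+1 = A ^+ m.+1 + m.+1%:Z * A ^+ m * u + u ^+ 2 * t}.
Proof.
elim: m => [|m [t IH]]; first by exists 0; ring.
exists (A * t + m.+1%:Z * A ^+ m + u * t); rewrite exprS IH.
by rewrite (_ : m.+2%:Z = m.+1%:Z + 1) ?[A ^+ _.+1]exprS; [ring | lia].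
Qed.

Lemma sum_in_setT {I : finType} (a : I -> int) :
  \sum_(i in [set: I]) a i = \sum_i a i.
Proof. by apply: eq_bigl => i; rewrite inE. Qed.

(** The coefficients of the differential of the equation at the point with all
    unknowns equal to A = \sum_i a i, divided by A ^+ n.-1. *)
Definition tangent_coef {s : nat} (n : nat) (a : 'I_s -> int) (j : 'I_s.+1) :
    int :=
  if unlift ord_max j is Some i then n%:Z * a i
  else - (n.+1%:Z * \sum_i a i).

(** For J without the index of y the sum is n times a subset sum of a, and the
    first hypothesis applies.  If J contains that index and G is the set of the other ones, the
    sum is - (n + 1) A + n (sum over G), which is the opposite of
    A + n (sum over the complement of G): the second hypothesis handles G
    nonempty, and the first one, on the whole index set, handles G empty. *)
Lemma tangent_coef_sum_neq0 {n s : nat} {a : 'I_s -> int} :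
  (0 < n)%N -> (0 < s)%N ->
  (forall G : {set 'I_s}, G != set0 -> \sum_(i in G) a i != 0) ->
  (forall G : {set 'I_s}, G != set0 ->
    \sum_(i < s) a i + n%:Z * \sum_(i in ~: G) a i != 0) ->
  forall J : {set 'I_s.+1}, J != set0 -> \sum_(j in J) tangent_coef n a j != 0.
Proof.
move=> n_gt0 s_gt0 h1 h2 J J0; pose G := [set i | lift ord_max i \in J].
have A_neq0 : \sum_i a i != 0.
  rewrite -sum_in_setT.
  by apply: h1; rewrite -card_gt0 cardsT card_ord.
have GE : \sum_(i | lift ord_max i \in J) tangent_coef n a (lift ord_max i)
          = n%:Z * \sum_(i in G) a i.
  rewrite mulr_sumr; apply: eq_big => i; first by rewrite inE.
  by rewrite /tangent_coef liftK.
have [maxJ | maxJ] := boolP (ord_max \in J).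
  rewrite (bigD1_ord ord_max) //= GE /tangent_coef unlift_none.
  have [G0 | /h2 hG] := eqVneq G set0.
    by rewrite G0 big_set0 mulr0 addr0 oppr_eq0 mulf_neq0.
  have AE : \sum_i a i = \sum_(i in G) a i + \sum_(i in ~: G) a i.
    rewrite (bigID (mem G)) /=; congr (_ + _).
    by apply: eq_bigl => i; rewrite in_setC.
  rewrite -oppr_eq0; apply: contraNneq hG => e0.
  rewrite -[X in _ == X]e0 AE (_ : n.+1%:Z = n%:Z + 1); last by lia.
  by apply/eqP; ring.
rewrite big_mkcond (bigD1_ord ord_max) //= (negPf maxJ) add0r -big_mkcond /= GE.
rewrite mulf_neq0 //; first by lia.
apply: h1; case/set0Pn: J0 => j jJ.
case: (unliftP ord_max j) jJ => [i -> iJ | -> jJ]; last by rewrite jJ in maxJ.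
by apply/set0Pn; exists i; rewrite inE.
Qed.

(** * Monochromatic solutions *)

(** Comparing valuations in the equation gives n v = (n + 1) w, where v is the
    least valuation of the x i and w that of y; the colouring f of valuations
    rules this out for v > 0. *)
Lemma solution_unramified {n s p : nat} {a : 'I_s -> int} {f : nat -> bool}
    {x : 'I_s -> nat} {y : nat} {d : 'F_p} :
    (0 < n)%N -> (0 < s)%N -> prime p ->
    (forall v w, (0 < v)%N -> (n.+1 * w = n * v)%N -> f v != f w) ->
    (forall G : {set 'I_s}, G != set0 -> ~~ (p %| \sum_(i in G) a i)%Z) ->
    (forall i, (0 < x i)%N) -> (forall i, digit p (x i) = d) ->
    (forall i, f (logn p (x i)) = f (logn p y)) ->
    \sum_i a i * (x i)%:Z ^+ n = y%:Z ^+ n.+1 ->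
  logn p y = 0%N.
Proof.
move=> n_gt0 s_gt0 p_pr hf ha x_gt0 xd xf xy.
have x0 i : (x i)%:Z != 0 by rewrite -lt0n x_gt0.
have [j [_ _]] := same_digit_power_sum (Ordinal s_gt0) p_pr n_gt0 ha x0 xd.
rewrite xy abszX lognX !absz_nat => vE.
have [v0 | v_gt0] := posnP (logn p (x j)); first by rewrite v0 in vE; lia.
by have := hf _ _ v_gt0 vE; rewrite xf eqxx.
Qed.

(** With v > 0 the least valuation of the u j, the linear part of the equation
    has valuation exactly v, while p^(v+1) divides every u j ^+ 2 and therefore
    the remainder; the two cannot cancel. *)
Lemma no_solution_near_constant {n s p : nat} {a : 'I_s -> int}
    {u : 'I_s.+1 -> int} {d : 'F_p} :
    (0 < n)%N -> prime p -> ~~ (p %| \sum_i a i)%Z ->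
    (forall J : {set 'I_s.+1}, J != set0 ->
      ~~ (p %| \sum_(j in J) tangent_coef n a j)%Z) ->
    (forall j, u j != 0) -> (forall j, (p %| u j)%Z) ->
    (forall j, digit p (u j) = d) ->
  power_sum_eqn n a (fun j => \sum_i a i + u j) != 0.
Proof.
case: n => // m _ p_pr; set A := \sum_i a i => pA hc u0 pu ud.
have [l [lmin S0 vS]] := same_digit_power_sum ord_max p_pr (ltn0Sn 0) hc u0 ud.
set v := logn p `|u l| in lmin vS; rewrite mul1n in vS.
set S := \sum_j _ in S0 vS.
have v_gt0 : (0 < v)%N by rewrite -dvdz_logn // expr1.
have pu2 j : (p%:Z ^+ v.+1 %| u j ^+ 2)%Z.
  by rewrite dvdz_logn ?expf_neq0 // abszX lognX; have := lmin j; lia.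
have A0 : A != 0 by apply: contraNneq pA => ->.
have vAS : logn p `|A ^+ m * S| = v.
  rewrite abszM abszX lognM ?expn_gt0 ?absz_gt0 ?A0 // lognX vS.
  by rewrite (@logn_coprime p `|A|) ?muln0 // prime_coprime.
have SE : S = \sum_i m.+1%:Z * a i * u (lift ord_max i) -
              m.+2%:Z * A * u ord_max.
  rewrite /S (bigD1_ord ord_max) //= /tangent_coef unlift_none expr1 addrC -/A.
  rewrite mulNr; congr (_ - _); apply: eq_bigr => i _.
  by rewrite liftK expr1.
(* S is the linear part up to the unit A ^+ m, and R is the quadratic remainder. *)
suff [R pR ->] : exists2 R, (p%:Z ^+ v.+1 %| R)%Z &
    power_sum_eqn m.+1 a (fun j => A + u j) = A ^+ m * S + R.
  apply/eqP => /eqP; rewrite addrC addr_eq0 => /eqP RE.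
  move: pR; rewrite RE rpredN dvdz_logn //; last by rewrite mulf_neq0 ?expf_neq0.
  by rewrite vAS ltnn.
pose t j k := sval (linearize_exp A (u j) k).
have tE j k : (A + u j) ^+ k.+1 =
    A ^+ k.+1 + k.+1%:Z * A ^+ k * u j + u j ^+ 2 * t j k.
  exact: svalP (linearize_exp A (u j) k).
exists (\sum_i a i * (u (lift ord_max i) ^+ 2 * t (lift ord_max i) m)
        - u ord_max ^+ 2 * t ord_max m.+1).
  apply: rpredB; last by rewrite dvdz_mulr.
  apply: rpred_sum => i _.
  by rewrite dvdz_mull // dvdz_mulr.
rewrite /power_sum_eqn tE SE.
rewrite (eq_bigr (fun i => a i * A ^+ m.+1 + A ^+ m *
   (m.+1%:Z * a i * u (lift ord_max i)) +
   a i * (u (lift ord_max i) ^+ 2 * t (lift ord_max i) m))) => [|i _].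
  rewrite !big_split /= -mulr_suml -mulr_sumr -/A !exprS; ring.
rewrite tE; ring.
Qed.

Theorem theorem2p8 (n s : nat) (a : 'I_s -> int)
  (n_gt0 : (0 < n)%N) (s_gt0 : (0 < s)%N)
  (h1 : forall G : {set 'I_s}, G != set0 -> \sum_(i in G) a i != 0)
  (h2 : forall G : {set 'I_s}, G != set0 ->
    \sum_(i < s) a i + n%:Z * \sum_(i in ~: G) a i != 0) :
  not_PR_except_constant (power_sum_eqn n a).
Proof.
set A := \sum_i a i in h2 *.
have tangent_neq0 := tangent_coef_sum_neq0 n_gt0 s_gt0 h1 h2.
have [p p_pr p_avoids] := prime_avoiding (fun K : {set 'I_s} + {set 'I_s.+1} =>
  match K with
  | inl G => \sum_(i in G) a i
  | inr J => \sum_(j in J) tangent_coef n a j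
  end).
have pG G (G0 : G != set0) := p_avoids (inl G) (h1 G G0).
have pJ J (J0 : J != set0) := p_avoids (inr J) (tangent_neq0 J J0).
have pA : ~~ (p %| A)%Z.
  rewrite /A -sum_in_setT.
  by apply: pG; rewrite -card_gt0 cardsT card_ord.
have [f hf] := separating_coloring _ n_gt0.
(* 'F_p is finite, so these tuples range over a finite type, and enum_rank turns
   them into colours. *)
pose color (x : nat) := (x%:Z == A, logn p x == 0%N, f (logn p x),
  digit p x, digit p (x%:Z - A)).
eexists; exists (fun x => enum_rank (color x)) => z [z_gt0 z_sol] [k z_mono].
have same j : color (z j) = color (z ord_max).
  by apply: enum_rank_inj; rewrite !z_mono.
have [zA | zA] := eqVneq (z ord_max)%:Z A.
  suff zE j : (z j)%:Z = A by move=> i j; have := zE i; have := zE j; lia.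
  by apply/eqP; have [-> _ _ _ _] := same j; rewrite zA.
have eqn : \sum_i a i * (z (lift ord_max i))%:Z ^+ n = (z ord_max)%:Z ^+ n.+1.
  by apply/eqP; rewrite -subr_eq0; apply/eqP.
have y_unram : logn p (z ord_max) = 0%N.
  apply: (solution_unramified n_gt0 s_gt0 p_pr hf pG _ _ _ eqn) => // i.
    by have [_ _ _ -> _] := same (lift ord_max i).
  by have [_ _ -> _ _] := same (lift ord_max i).
have pz j : ~~ (p %| (z j)%:Z)%Z.
  have [_ v0 _ _ _] := same j; rewrite y_unram eqxx in v0.
  by rewrite -[X in (X %| _)%Z]expr1 dvdz_logn ?(eqP v0) // -lt0n.
pose d : 'F_p := (z ord_max)%:Z%:~R.
have zd j : (z j)%:Z%:~R = d.
  by have [_ _ _ + _] := same j; rewrite !digit_unramified.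
(* Reduced modulo p the equation is A * d ^+ n = d ^+ n.+1, with d a unit. *)
have dA : d = A%:~R.
  have d0 : d != 0 by rewrite Fp_intr_eq0.
  apply: (mulIf (expf_neq0 n d0)); rewrite -exprS /d -rmorphXn -eqn.
  rewrite /A !rmorph_sum mulr_suml; apply: eq_bigr => i _.
  by rewrite /= rmorphM rmorphXn /= !zd.
have pu j : (p %| (z j)%:Z - A)%Z.
  by rewrite -Fp_intr_eq0 // rmorphB /= zd dA subrr.
have /eqP[] : power_sum_eqn n a (fun j => A + ((z j)%:Z - A)) != 0.
  apply: (no_solution_near_constant n_gt0 p_pr pA pJ _ pu) => j.
    by have [jA _ _ _ _] := same j; rewrite subr_eq0 jA.
  by have [_ _ _ _] := same j; apply.
rewrite -z_sol /power_sum_eqn; congr (_ - _); last by rewrite addrC subrK.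
by apply: eq_bigr => i _; rewrite addrC subrK.
Qed.
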